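(* Let $F$ be an absolutely continuous distribution function on $[0,1]$ that is twice differentiable, with density $f=F'$ and quantile function $Q$. Assume $$\inf_{0\le x\le 1} f(Q(x))>0\quad\text{and}\quad \sup_{0\le x\le1}|f'(Q(x))|<\infty .$$ For each $n\ge 2$ let $x_1,\dots,x_{n-1}$ be i.i.d. random variables with distribution function $F$, with order statistics $x_{1:n}<\dots<x_{n-1:n}$ (almost surely), set $x_{0:n}=0$ and $x_{n:n}=1$, and let $p_i=x_{i:n}-x_{i-1:n}$, $i=1,\dots,n$, be the spacings, so that $(p_1,\dots,p_n)$ lies in the simplex $\Delta_{n-1}=\{x\in\mathbb{R}^n:\ x_i\ge0,\ \sum_{i=1}^n x_i=1\}$; regard it as the vector of increments over the fixed equi-spaced partition $\{i/n:\ i=0,\dots,n\}$ of $[0,1]$. Let $$Y_n(t)=\sum_{i=1}^{\lfloor nt\rfloor}p_i+(nt-\lfloor nt\rfloor)\,p_{\lfloor nt\rfloor+1},\qquad t\in[0,1].$$ Then $Y_n$ converges in probability to $Q$ in $C([0,1])$ equipped with the uniform topology, as $n\to\infty$.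
   Context: $F$ is the distribution function of a probability measure on $[0,1]$; derivatives of $F$ at the endpoints $0,1$ are one-sided. The quantile function $Q=F^{-1}$ on $(0,1)$ is extended to $[0,1]$ by $Q(0)=\lim_{t\to0}Q(t)=0$ and $Q(1)=\lim_{t\to1}Q(t)=1$. $C([0,1])$ is the space of real-valued continuous functions on $[0,1]$ with the norm $\|x\|=\sup_{0\le t\le1}|x(t)|$. At $t=1$ the term $(nt-\lfloor nt\rfloor)p_{\lfloor nt\rfloor+1}$ is interpreted as $0$. *)

(* Defs.v *)
From HB Require Import structures.
From mathcomp Require Import all_boot all_order all_algebra.
From mathcomp Require Import all_classical all_reals all_analysis.

Set Implicit Arguments.
Unset Strict Implicit.
Unset Printing Implicit Defensive.

Import Order.TTheory GRing.Theory Num.Theory.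
Import numFieldNormedType.Exports.

Local Open Scope classical_set_scope.
Local Open Scope ring_scope.

Definition distribution_function01 (R : realType) (F : R -> R) : Prop :=
  exists mu : probability (measurableTypeR R) R,
    mu `[0, 1]%classic = 1%E /\ forall x, mu `]-oo, x]%classic = (F x)%:E.

(* Absolute continuity is required on the whole line, as usual for a
   distribution function: for one carried by [0, 1] this is absolute
   continuity on [0, 1] together with F 0 = 0 (no atom at 0). *)
Definition absolutely_continuous (R : realType) (F : R -> R) : Prop :=
  forall e : R, 0 < e -> exists2 d : R, 0 < d &
    forall (m : nat) (a b : 'I_m -> R),
      (forall i, a i <= b i) -> trivIset setT (fun i => `]a i, b i[%classic) ->
      \sum_(i < m) (b i - a i) < d -> \sum_(i < m) `|F (b i) - F (a i)| < e.

(* [dg] is the derivative of [g] on [0, 1], one-sided at the endpoints; only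
   the values of [g] and [dg] on [0, 1] matter. *)
Definition is_derivative01 (R : realType) (g dg : R -> R) : Prop :=
  [/\ forall x : R, x \in `]0, 1[ -> is_derive x (1 : R) g (dg x),
      h^-1 * (g (0 + h) - g 0) @[h --> 0^'+] --> dg 0 &
      h^-1 * (g (1 + h) - g 1) @[h --> 0^'-] --> dg 1].

Definition quantile (R : realType) (F : R -> R) (t : R) : R :=
  inf [set x | t <= F x].

(* The quantile function on (0, 1), extended to the endpoints by its limits. *)
Definition quantile01 (R : realType) (F : R -> R) (t : R) : R :=
  if t <= 0 then lim (quantile F s @[s --> 0^'+])
  else if 1 <= t then lim (quantile F s @[s --> 1^'-])
  else quantile F t.

(* x_{i:n} for 0 <= i <= n, from the n - 1 sample points [x], with
   x_{0:n} = 0 and x_{n:n} = 1. *)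
Definition order_statistic (R : realType) (n : nat) (x : 'I_n.-1 -> R)
    (i : nat) : R :=
  nth 0 (0 :: rcons (sort <=%R [seq x j | j : 'I_n.-1]) 1) i.

(* p_i, meaningful for 1 <= i <= n. *)
Definition spacing (R : realType) (n : nat) (x : 'I_n.-1 -> R) (i : nat) : R :=
  order_statistic x i - order_statistic x i.-1.

(* At t = 1 the last summand is 0 * spacing x n.+1 = 0. *)
Definition spacing_path (R : realType) (n : nat) (x : 'I_n.-1 -> R)
    (t : R) : R :=
  let k := Num.truncn (n%:R * t) in
  \sum_(1 <= i < k.+1) spacing x i + (n%:R * t - k%:R) * spacing x k.+1.

Definition mutually_independent d (T : measurableType d) (R : realType)
    (P : probability T R) (m : nat) (X : 'I_m -> {RV P >-> R}) : Prop :=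
  forall (J : {set 'I_m}) (B : 'I_m -> set R),
    (forall i, measurable (B i)) ->
    P (\bigcap_(i in [set` J]) (X i @^-1` B i)) =
    (\prod_(i in J) P (X i @^-1` B i))%E.

Arguments mutually_independent {d T R} P {m} X.

Definition iid_with_cdf d (T : measurableType d) (R : realType)
    (P : probability T R) (m : nat) (X : 'I_m -> {RV P >-> R})
    (F : R -> R) : Prop :=
  mutually_independent P X /\ forall i r, cdf (X i) r = (F r)%:E.

Arguments iid_with_cdf {d T R} P {m} X F.

(* Elements of C([0, 1]) are represented by functions on R, of which only the
   restriction to [0, 1] is used. *)
Definition C01 (R : realType) (g : R -> R) : Prop :=
  {within `[0, 1], continuous g}.

Definition supnorm01 (R : realType) (g : R -> R) : R :=
  sup [set `|g t| | t in `[0 : R, 1]].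

(* Random elements of C([0, 1]): as this space is separable, its Borel
   sigma-algebra is generated by the open balls. *)
Definition random_element_C01 d (T : measurableType d) (R : realType)
    (Y : T -> R -> R) : Prop :=
  (forall w, C01 (Y w)) /\
  forall (g : R -> R) (r : R), C01 g ->
    measurable [set w | supnorm01 (Y w \- g) < r].

Definition cvg_in_probability_C01 d (T : measurableType d) (R : realType)
    (P : probability T R) (Y : nat -> T -> R -> R) (Q : R -> R) : Prop :=
  [/\ C01 Q,
      \forall n \near \oo, random_element_C01 (Y n) &
      forall e : R, 0 < e ->
        P [set w | e <= supnorm01 (Y n w \- Q)] @[n --> \oo] --> 0%E].

(* Main.v *)
Require Import Defs.
From HB Require Import structures.
From mathcomp Require Import all_boot all_order all_algebra.
From mathcomp Require Import all_classical all_reals all_analysis.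
From mathcomp Require Import measurable_realfun ring lra.

Set Implicit Arguments.
Unset Strict Implicit.
Unset Printing Implicit Defensive.

Import Order.TTheory GRing.Theory Num.Theory.
Import numFieldNormedType.Exports.

Local Open Scope classical_set_scope.
Local Open Scope ring_scope.

(* Since F (Q t) = t, positivity of f at the points Q t forbids flat pieces of F
   (including near the endpoints of its support), so Q maps [0, 1] onto [0, 1];
   hence f >= c > 0 on [0, 1], F expands distances by at least c, and Q is
   Lipschitz. For a grid {j / m} of [0, 1], Chebyshev's inequality bounds by
   O(1 / n) the probability that the number of sample points below some j / m
   deviates from (n - 1) F (j / m) by more than n times a small constant. Off
   this event, the order statistics of rank near n t lie within 2 / m of Q t,
   and so does Y_n(t), a convex combination of two of them. *)

(** * The distribution function and its quantile function *)

Section distribution_function.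
Context (R : realType) (F : R -> R).
Hypothesis F_df : distribution_function01 F.
Hypothesis F_ac : absolutely_continuous F.

Lemma df_homo : {homo F : x y / x <= y}.
Proof.
case: F_df => mu [_ muF] x y xy; rewrite -lee_fin -!muF.
apply: le_measure; rewrite ?inE//.
by apply: subset_itvl; rewrite bnd_simp.
Qed.

(** Absolute continuity, used with a family made of one interval, is uniform continuity. *)
Lemma ac_continuous : continuous F.
Proof.
move=> x; apply/cvgrPdist_lt => e e0; have [d d0 dF] := F_ac e0.
have H u v : u <= v -> v - u < d -> `|F v - F u| < e.
  move=> uv vud; have := @dF 1%N (fun=> u) (fun=> v).
  rewrite !big_ord1; apply => //.
  by move=> i j _ _ _; rewrite (ord1 i) (ord1 j).
near=> y; have xyd : `|x - y| < d by near: y; exact: cvgr_dist_lt.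
have [xy|/ltW yx] := leP x y.
  by rewrite distrC H// -(@ger0_norm _ (y - x)) ?subr_ge0// distrC.
by rewrite H// -(@ger0_norm _ (x - y)) ?subr_ge0.
Unshelve. all: by end_near. Qed.

Lemma df_lt0 x : x < 0 -> F x = 0.
Proof.
case: F_df => mu [mu01 muF] x0; apply/EFin_inj; rewrite -muF.
apply/eqP; rewrite eq_le measure_ge0 andbT.
have -> : 0%:E = (1%:E - mu `[0%R, 1%R]%classic)%E by rewrite mu01 subee.
rewrite -probability_setC//.
apply: le_measure; rewrite ?inE//; first exact: measurableC.
move=> y /=; rewrite !in_itv/= => yx /andP[y0 _].
by move: (le_lt_trans (le_trans y0 yx) x0); rewrite ltxx.
Qed.

(** Continuity excludes an atom at 0: the value is the limit of the zeros on the left. *)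
Lemma df0 : F 0 = 0.
Proof.
have H : F x @[x --> 0^'-] --> F 0 by apply: cvg_at_left_filter; exact: ac_continuous.
apply: (cvg_unique _ H) => //.
apply/cvgrPdist_lt => e e0; near=> x.
by rewrite df_lt0 ?subrr ?normr0.
Unshelve. all: by end_near. Qed.

Lemma df_ge1 x : 1 <= x -> F x = 1.
Proof.
case: F_df => mu [mu01 muF] x1; apply/EFin_inj; rewrite -muF.
apply/eqP; rewrite eq_le probability_le1//=.
rewrite -mu01; apply: le_measure; rewrite ?inE//.
by move=> y /=; rewrite !in_itv/= => /andP[_ /le_trans]; apply.
Qed.

Lemma df1 : F 1 = 1.
Proof. exact: df_ge1. Qed.

Lemma quantile_in01 t : 0 < t < 1 -> 0 <= quantile F t <= 1.
Proof.
move=> /andP[t0 t1].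
have lb : lbound [set x | t <= F x] 0.
  move=> x /= tx; rewrite leNgt; apply/negP => /df_lt0 F0.
  by move: (lt_le_trans t0 tx); rewrite F0 ltxx.
apply/andP; split.
  by apply: lb_le_inf => //; exists 1; rewrite /= df1 ltW.
by apply: ge_inf; [exists 0 | rewrite /= df1 ltW].
Qed.

(** The intermediate value theorem puts a solution of [F x = t] in the set whose infimum is taken,
    so [F (quantile F t) <= t]. Were this strict, it would persist a little to the right of the
    infimum, yet points of the set lie arbitrarily close to it. *)
Lemma quantileK t : 0 < t < 1 -> F (quantile F t) = t.
Proof.
move=> t01; have /andP[t0 t1] := t01.
have [x /itvP x01 Fxt] : exists2 x, x \in `[0, 1] & F x = t.
  apply: IVT => //; first exact/continuous_subspaceT/ac_continuous.
  by rewrite df0 df1 min_l// max_r// !ltW.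
have lb : has_lbound [set x | t <= F x].
  exists 0 => y /= tx; rewrite leNgt; apply/negP => /df_lt0 F0.
  by move: (lt_le_trans t0 tx); rewrite F0 ltxx.
have qx : quantile F t <= x by apply: ge_inf => //=; rewrite Fxt.
apply/eqP; rewrite eq_le; apply/andP; split; first by rewrite -[leRHS]Fxt df_homo.
rewrite leNgt; apply/negP => Fq.
have Fqr : F y @[y --> (quantile F t)^'+] --> F (quantile F t).
  by apply: cvg_at_right_filter; exact: ac_continuous.
near (quantile F t)^'+ => y.
have Fy : F y < t by near: y; exact: cvgr_lt Fqr _ Fq.
have [||z /= tz zy] := @inf_adherent _ [set y | t <= F y] (y - quantile F t).
- by rewrite subr_gt0; near: y; exact: nbhs_right_gt.
- by split=> //; exists x; rewrite /= Fxt.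
move: zy; rewrite addrC subrK => /ltW /df_homo.
by move/(le_trans tz); rewrite leNgt Fy.
Unshelve. all: by end_near. Qed.

Lemma quantile_le x t : 0 < t < 1 -> t <= F x -> quantile F t <= x.
Proof.
move=> /andP[t0 t1] tF; apply: ge_inf => //.
exists 0 => y /= tx; rewrite leNgt; apply/negP => /df_lt0 F0.
by move: (lt_le_trans t0 tx); rewrite F0 ltxx.
Qed.

Lemma quantile_homo s t : 0 < s < 1 -> 0 < t < 1 -> s <= t ->
  quantile F s <= quantile F t.
Proof. by move=> s01 t01 st; apply: quantile_le => //; rewrite quantileK. Qed.

(** Monotonicity and boundedness make the one-sided limit exist, so [lim] is not a default value;
    [F (quantile F s) = s] then passes to the limit by continuity. The limit itself may be positive
    here, since [F] could still be flat near 0. *)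
Lemma quantile01_0 : 0 <= quantile01 F 0 <= 1 /\ F (quantile01 F 0) = 0.
Proof.
rewrite /quantile01 lexx.
have lt1 : \forall x \near 0^'+, x < 1 :> R by exact: nbhs_right_lt.
have : cvg (quantile F s @[s --> 0^'+]).
  apply: nondecreasing_at_right_is_cvgr.
    apply: filterS lt1 => x x1 y z; rewrite !in_itv/= => /andP[y0 yx] /andP[z0 zx] yz.
    by rewrite quantile_homo ?y0 ?z0 ?(lt_trans yx) ?(lt_trans zx).
  apply: filterS lt1 => x x1; exists 0 => _ [y /= + <-]; rewrite in_itv/= => /andP[y0 yx].
  by have /andP[] : 0 <= quantile F y <= 1 by rewrite quantile_in01// y0 (lt_trans yx).
move/cvg_ex => [l Ql].
rewrite (cvg_lim _ Ql)//.
have near01 : \forall s \near 0^'+, (0 < (s : R) < 1).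
  by near=> s; apply/andP; split.
split.
  apply/andP; split.
    apply: (cvgr_to_ge Ql); apply: filterS near01 => s s01.
    by have /andP[] := quantile_in01 s01.
  apply: (cvgr_to_le Ql); apply: filterS near01 => s s01.
  by have /andP[] := quantile_in01 s01.
have FQ : F (quantile F s) @[s --> 0^'+] --> F l.
  by apply: continuous_cvg => //; exact: ac_continuous.
apply: (cvg_unique _ FQ) => //.
apply: (@cvg_trans _ (s @[s --> 0^'+])); last by apply: cvg_at_right_filter; exact: cvg_id.
by apply: near_eq_cvg; apply: filterS near01 => s s01; rewrite quantileK.
Unshelve. all: by end_near. Qed.

Lemma quantile01_1 : 0 <= quantile01 F 1 <= 1 /\ F (quantile01 F 1) = 1.
Proof.
rewrite /quantile01 ler10 lexx.
have gt0 : \forall x \near 1^'-, 0 < x :> R by exact: nbhs_left_gt.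
have : cvg (quantile F s @[s --> 1^'-]).
  apply: nondecreasing_at_left_is_cvgr.
    apply: filterS gt0 => x x0 y z; rewrite !in_itv/= => /andP[xy y1] /andP[xz z1] yz.
    by rewrite quantile_homo ?y1 ?z1 ?(lt_trans x0 xy) ?(lt_trans x0 xz).
  apply: filterS gt0 => x x0; exists 1 => _ [y /= + <-]; rewrite in_itv/= => /andP[xy y1].
  by have /andP[] : 0 <= quantile F y <= 1 by rewrite quantile_in01// y1 (lt_trans x0 xy).
move/cvg_ex => [l Ql].
rewrite (cvg_lim _ Ql)//.
have near01 : \forall s \near 1^'-, (0 < (s : R) < 1).
  by near=> s; apply/andP; split.
split.
  apply/andP; split.
    apply: (cvgr_to_ge Ql); apply: filterS near01 => s s01.
    by have /andP[] := quantile_in01 s01.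
  apply: (cvgr_to_le Ql); apply: filterS near01 => s s01.
  by have /andP[] := quantile_in01 s01.
have FQ : F (quantile F s) @[s --> 1^'-] --> F l.
  by apply: continuous_cvg => //; exact: ac_continuous.
apply: (cvg_unique _ FQ) => //.
apply: (@cvg_trans _ (s @[s --> 1^'-])); last by apply: cvg_at_left_filter; exact: cvg_id.
by apply: near_eq_cvg; apply: filterS near01 => s s01; rewrite quantileK.
Unshelve. all: by end_near. Qed.

Lemma quantile01_in01 t : 0 <= t <= 1 -> 0 <= quantile01 F t <= 1.
Proof.
move=> /andP[]; rewrite le_eqVlt => /predU1P[<- _|t0].
  by have [] := quantile01_0.
rewrite le_eqVlt => /predU1P[->|t1]; first by have [] := quantile01_1.
by rewrite /quantile01 (leNgt t) t0 (leNgt 1) t1/= quantile_in01// t0.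
Qed.

Lemma quantile01K t : 0 <= t <= 1 -> F (quantile01 F t) = t.
Proof.
move=> /andP[]; rewrite le_eqVlt => /predU1P[<- _|t0].
  by have [] := quantile01_0.
rewrite le_eqVlt => /predU1P[->|t1]; first by have [] := quantile01_1.
by rewrite /quantile01 (leNgt t) t0 (leNgt 1) t1/= quantileK// t0.
Qed.

(** * Lower bound on the density and continuity of the quantile function *)

Variable f : R -> R.
Hypothesis F_f : is_derivative01 F f.
Hypothesis f_inf :
  (0 < ereal_inf [set (f (quantile01 F x))%:E | x in `[0%R : R, 1%R]])%E.

Lemma derivative01_right x : 0 <= x < 1 ->
  h^-1 * (F (x + h) - F x) @[h --> 0^'+] --> f x.
Proof.
case: F_f => dF dF0 _ /andP[]; rewrite le_eqVlt => /predU1P[<- //|x0 x1].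
have /dF [/cvg_ex[l dl] <-] : x \in `]0, 1[ by rewrite in_itv/= x0.
rewrite /derive (cvg_lim _ dl)//.
move: dl => /cvg_dnbhs_at_right; apply: cvg_trans.
by apply: near_eq_cvg; near=> h => /=; rewrite [h *: 1]mulr1 (addrC x).
Unshelve. all: by end_near. Qed.

Lemma derivative01_left x : 0 < x <= 1 ->
  h^-1 * (F (x + h) - F x) @[h --> 0^'-] --> f x.
Proof.
case: F_f => dF _ dF1 /andP[x0]; rewrite le_eqVlt => /predU1P[-> //|x1].
have /dF [/cvg_ex[l dl] <-] : x \in `]0, 1[ by rewrite in_itv/= x0.
rewrite /derive (cvg_lim _ dl)//.
move: dl => /cvg_dnbhs_at_left; apply: cvg_trans.
by apply: near_eq_cvg; near=> h => /=; rewrite [h *: 1]mulr1 (addrC x).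
Unshelve. all: by end_near. Qed.

(* F cannot be flat on either side of a point where its derivative is nonzero. *)
Lemma density_gt0_injective x y : 0 <= x <= 1 -> 0 <= y <= 1 ->
  0 < f x -> F x = F y -> x = y.
Proof.
move=> /andP[x0 x1] /andP[y0 y1] fx Fxy.
case: (ltgtP x y) => // xy; exfalso; move: fx; apply/negP; rewrite -leNgt.
  have /derivative01_right/cvgr_to_le : 0 <= x < 1 by rewrite x0 (lt_le_trans xy).
  (* For small [h > 0], [F (x + h) <= F y = F x]: the difference quotients are nonpositive, hence so
     is their limit [f x]. *)
  apply; near=> h; rewrite pmulr_rle0 ?invr_gt0// subr_le0 Fxy df_homo//.
  by rewrite -lerBrDl; near: h; apply: nbhs_right_le; rewrite subr_gt0.
have /derivative01_left/cvgr_to_le : 0 < x <= 1 by rewrite x1 (le_lt_trans y0).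
apply; near=> h; rewrite nmulr_rle0 ?invr_lt0// subr_ge0 Fxy df_homo//.
by rewrite -lerBlDl; near: h; apply: nbhs_left_ge; rewrite subr_lt0.
Unshelve. all: by end_near. Qed.

(** The hypothesis bounds [f] below only at quantiles. But [x] and [quantile01 F (F x)] have the
    same image under [F], and [f] is positive at the latter, so they coincide; the bound thus holds
    on all of [[0, 1]] and the mean value theorem concludes. *)
Lemma df_expanding : exists2 c : R, 0 < c &
  forall x y, 0 <= x -> x <= y -> y <= 1 -> c * (y - x) <= F y - F x.
Proof.
have [c c0 fQ] : exists2 c : R, 0 < c & forall t, 0 <= t <= 1 -> c <= f (quantile01 F t).
  have [c /andP[c0 cinf]] : exists c : R, (0 < c%:E <= ereal_inf [set (f (quantile01 F x))%:E | x in `[0%R : R, 1%R]])%E.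
    (* The infimum is an extended real: a finite value is its own witness, and 1 does for [+oo]. *)
    move: f_inf; case: ereal_inf => [r r0|_|//]; first by exists r; rewrite r0/=.
    by exists 1; rewrite lte01 leey.
  exists c => // t t01; rewrite -lee_fin (le_trans cinf)//.
  by apply: ereal_inf_lbound; exists t; rewrite //= in_itv.
have fc x : 0 <= x <= 1 -> c <= f x.
  move=> x01; have Fx01 : 0 <= F x <= 1.
    by have /andP[x0 x1] := x01; rewrite -df0 -df1 !df_homo.
  have cQ := fQ _ Fx01.
  rewrite -(@density_gt0_injective (quantile01 F (F x)) x)//.
  - exact: quantile01_in01.
  - exact: lt_le_trans cQ.
  - exact: quantile01K.
exists c => // x y x0 xy y1.
have [z zxy ->] : exists2 z, z \in `[x, y] & F y - F x = f z * (y - x).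
  apply: MVT_segment => //.
    move=> z; rewrite in_itv/= => /andP[xz zy]; case: F_f => dF _ _.
    by apply: dF; rewrite in_itv/= (le_lt_trans x0) ?(lt_le_trans zy).
  exact/continuous_subspaceT/ac_continuous.
rewrite ler_wpM2r ?subr_ge0// fc//; move: zxy; rewrite in_itv/= => /andP[xz zy].
by rewrite (le_trans x0) ?(le_trans zy).
Qed.

(** Applied to two quantiles, the expansion bound becomes a Lipschitz bound with constant [c^-1],
    valid up to the endpoints. *)
Lemma quantile01_continuous : C01 (quantile01 F).
Proof.
have [c c0 cF] := df_expanding.
have lip s t : 0 <= s <= 1 -> 0 <= t <= 1 ->
    c * `|quantile01 F s - quantile01 F t| <= `|s - t|.
  move=> s01 t01; rewrite -[in leRHS](quantile01K s01) -[in leRHS](quantile01K t01).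
  have /andP[Qs0 Qs1] := quantile01_in01 s01.
  have /andP[Qt0 Qt1] := quantile01_in01 t01.
  have [st|/ltW ts] := leP (quantile01 F s) (quantile01 F t).
    rewrite distrC [leRHS]distrC !ger0_norm ?subr_ge0 ?df_homo//.
    exact: cF.
  rewrite !ger0_norm ?subr_ge0 ?df_homo//.
  exact: cF.
apply/subspace_continuousP => x /=; rewrite in_itv/= => x01.
apply/cvgrPdist_lt => e e0; rewrite near_withinE; near=> t => /=.
rewrite in_itv/= => t01.
rewrite -(ltr_pM2l c0) (le_lt_trans (lip _ _ x01 t01))//.
by near: t; apply: cvgr_dist_lt; rewrite ?mulr_gt0.
Unshelve. all: by end_near. Qed.

End distribution_function.

(** * Order statistics and the interpolated spacing path *)

(** This truncation serves twice: as the ramp that builds the interpolated path, and as the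
    retraction that extends a continuous function on [[0, 1]] to the line. *)
Definition clip01 (R : realType) (x : R) : R := Num.min 1 (Num.max 0 x).

Section clip01.
Context (R : realType).
Implicit Type x : R.

Lemma clip01_in01 x : 0 <= clip01 x <= 1.
Proof. by rewrite /clip01 ge_min lexx le_min ler01 le_max lexx. Qed.

Lemma clip01_eq0 x : x <= 0 -> clip01 x = 0.
Proof. by move=> x0; rewrite /clip01 max_l// min_r. Qed.

Lemma clip01_eq1 x : 1 <= x -> clip01 x = 1.
Proof. by move=> x1; rewrite /clip01 min_l// le_max x1 orbT. Qed.

Lemma clip01_id x : 0 <= x <= 1 -> clip01 x = x.
Proof. by move=> /andP[x0 x1]; rewrite /clip01 max_r// min_r. Qed.

Lemma clip01_continuous : continuous (@clip01 R).
Proof.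
move=> x; apply: continuous_min; first exact: cvg_cst.
by apply: continuous_max; [exact: cvg_cst | exact: cvg_id].
Qed.

End clip01.

Section order_statistic.
Context (R : realType) (n : nat).
Implicit Types (x : 'I_n.-1 -> R) (r t : R).

Lemma order_statistic_n x : (0 < n)%N -> order_statistic x n = 1.
Proof.
rewrite /order_statistic; case: n x => // m x _ /=.
by rewrite nth_rcons size_sort size_map size_enum_ord ltnn eqxx.
Qed.

Lemma order_statistic_inner x i : (i < n.-1)%N -> order_statistic x i.+1 =
  nth 0 (sort <=%R [seq x j | j : 'I_n.-1]) i.
Proof.
by move=> ni; rewrite /order_statistic /= nth_rcons size_sort size_map size_enum_ord ni.
Qed.

Lemma count_leE x r : count (<= r) [seq x j | j : 'I_n.-1] = (\sum_(j < n.-1) (x j <= r)%R)%N.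
Proof. by rewrite count_map -sum1_count big_mkcond/= big_enum. Qed.

(** In a sorted list an entry is at most [r] exactly when enough entries are. This trades order
    statistics for counts, which are sums of indicators. The shift by one is due to the 0 put in
    front of the sample. *)
Lemma order_statistic_le x i r : (i < n.-1)%N ->
  (order_statistic x i.+1 <= r) = (i < \sum_(j < n.-1) (x j <= r)%R)%N.
Proof.
move=> ni; rewrite order_statistic_inner// -count_leE -(count_sort <=%R).
have sst : sorted <=%R (sort <=%R [seq x j | j : 'I_n.-1]) by exact: sort_le_sorted.
apply/idP/idP => [|ir]; last exact: nth_count_le.
apply: contraLR; rewrite -leqNgt -ltNge => ir.
by apply: nth_count_gt => //; rewrite ir size_sort size_map size_enum_ord.
Qed.

(** Rank 0 is the added point 0, covered by [0 <= r]; the added point 1 has rank [n], out of reach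
    of a count of [n.-1] sample points. *)
Lemma order_statistic_ub x i r : (0 < n)%N -> 0 <= r ->
  (i <= \sum_(j < n.-1) (x j <= r)%R)%N -> order_statistic x i <= r.
Proof.
move=> n0 r0; case: i => [//|i] ir; rewrite order_statistic_le//.
rewrite (leq_trans ir)// -[leqRHS]card_ord -sum1_card.
by apply: leq_sum => j _; exact: leq_b1.
Qed.

(** Rank [n] is the added point 1, covered by [r <= 1]; rank 0 is excluded by the strict
    inequality. *)
Lemma order_statistic_lb x i r : r <= 1 -> (i <= n)%N ->
  (\sum_(j < n.-1) (x j <= r)%R < i)%N -> r <= order_statistic x i.
Proof.
move=> r1; case: i => [//|i]; rewrite leq_eqVlt => /predU1P[ni|ni] ri.
  by rewrite ni order_statistic_n -?ni.
rewrite ltW// ltNge order_statistic_le -?leqNgt// -ltnS prednK//.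
by rewrite (leq_trans _ ni).
Qed.

Lemma order_statistic_in01 x i : (forall j, 0 <= x j <= 1) -> (i <= n)%N ->
  0 <= order_statistic x i <= 1.
Proof.
move=> x01; case: i => [_|i]; first by rewrite lexx ler01.
rewrite leq_eqVlt => /predU1P[ni|ni].
  by rewrite ni order_statistic_n -?ni// ler01 lexx.
have ni1 : (i < n.-1)%N by rewrite -ltnS prednK// (leq_trans _ ni).
rewrite order_statistic_inner//.
have /mapP[j _ ->//] : nth 0 (sort <=%R [seq x j | j : 'I_n.-1]) i \in
    [seq x j | j : 'I_n.-1].
  by rewrite -(mem_sort <=%R) mem_nth// size_sort size_map size_enum_ord.
Qed.

(** The spacings telescope down to [order_statistic x 0], which is 0. For [0 <= t] this displays the
    path as a convex combination of two consecutive order statistics. *)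
Lemma spacing_pathE x t : let k := Num.truncn (n%:R * t) in
  spacing_path x t = order_statistic x k
    + (n%:R * t - k%:R) * (order_statistic x k.+1 - order_statistic x k).
Proof.
move=> k; rewrite /spacing_path -/k big_add1/=; congr +%R.
by rewrite /spacing/= telescope_sumr// subr0.
Qed.

(* Unlike the definition, this form is visibly continuous in t. *)
Lemma spacing_path_clip x t : 0 <= t <= 1 -> spacing_path x t =
  \sum_(i < n) spacing x i.+1 * clip01 (n%:R * t - i%:R).
Proof.
move=> /andP[t0 t1]; rewrite /spacing_path.
set k := Num.truncn _.
have /andP[kt tk] : k%:R <= n%:R * t < k.+1%:R by rewrite truncn_itv// mulr_ge0.
have kn : (k <= n)%N by rewrite -(ler_nat R) (le_trans kt)// ler_piMr.
(* At time [t] the ramps of index below [k] have reached 1 and those above [k] are still 0; only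
   ramp [k] is partial. *)
have lo i : (i < k)%N -> clip01 (n%:R * t - i%:R) = 1.
  move=> ik; apply: clip01_eq1; rewrite lerBrDr nat1r.
  by rewrite (le_trans _ kt)// ler_nat.
have hi i : (k < i)%N -> clip01 (n%:R * t - i%:R) = 0.
  move=> ki; apply: clip01_eq0; rewrite subr_le0 (le_trans (ltW tk))//.
  by rewrite ler_nat.
rewrite -(big_mkord xpredT (fun i => spacing x i.+1 * clip01 (n%:R * t - i%:R))).
rewrite [RHS](@big_cat_nat _ _ _ k)//= big_add1/=; congr +%R.
  by rewrite !big_nat; apply: eq_bigr => i /andP[_ ik]; rewrite lo// mulr1.
(* If [k = n] there is no ramp of index [k], but the interpolation weight is then 0. *)
move: kn; rewrite leq_eqVlt => /predU1P[kn|kn].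
  have -> : n%:R * t - k%:R = 0.
    by apply/eqP; rewrite subr_eq0 eq_le kt andbT kn ler_piMr.
  by rewrite mul0r big_geq ?kn.
rewrite big_ltn// big_nat big1 ?addr0 => [|i /andP[ki _]]; last by rewrite hi// mulr0.
rewrite mulrC clip01_id// subr_ge0 kt/= lerBlDr nat1r; exact: ltW.
Qed.


Lemma spacing_path_continuous x : C01 (spacing_path x).
Proof.
pose g t := \sum_(i < n) spacing x i.+1 * clip01 (n%:R * t - i%:R).
have gs : {in `[0, 1]%classic, g =1 spacing_path x}.
  by move=> t /set_mem/=; rewrite in_itv/= => t01; rewrite spacing_path_clip.
have cg : continuous g.
  apply: continuous_big => [|i _ t]; first exact: add_continuous.
  apply: cvgM; first exact: cvg_cst.
  apply: (@continuous_comp _ _ _ (fun t => n%:R * t - i%:R) (@clip01 R)).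
    apply: cvgB; last exact: cvg_cst.
    by apply: cvgM; [exact: cvg_cst | exact: cvg_id].
  exact: clip01_continuous.
by apply: subspace_eq_continuous gs _; exact: continuous_subspaceT.
Qed.
End order_statistic.


(** * Measurability of the path and of uniform balls *)

Lemma indic_preimage_ray (T : Type) (R : realType) (f : T -> R) r w :
  \1_(f @^-1` `]-oo, r]) w = (f w <= r)%R%:R :> R.
Proof.
rewrite indicE; congr (_%:R); congr nat_of_bool.
by apply/idP/idP => [/set_mem/=|fr]; [|apply/mem_set]; rewrite /= in_itv.
Qed.

(** An order statistic exceeds [r] exactly when few enough sample points are at most [r], an event
    about a finite sum of indicators. *)
Lemma measurable_order_statistic d (T : measurableType d) (R : realType) n
    (X : 'I_n.-1 -> T -> R) i : (forall j, measurable_fun setT (X j)) ->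
  measurable_fun setT (fun w => order_statistic (X ^~ w) i).
Proof.
move=> mX; case: i => [|i]; first exact: measurable_cst.
have [ni|ni] := ltnP i n.-1; last first.
  (* Past the sample the list yields the added point 1, then the default 0 of [nth]: a constant in
     both cases. *)
  rewrite (_ : (fun w => _) = cst (if i == n.-1 then 1 else 0)); last first.
    apply/funext => w /=; rewrite /order_statistic/= nth_rcons size_sort size_map.
    by rewrite size_enum_ord ltnNge ni.
  exact: measurable_cst.
move=> mT; apply: (measurability _ (RGenOInfty.measurableE R)) => //.
move=> /= _ [_ [r ->] <-]; rewrite setTI.
pose S w : R := \sum_(j < n.-1) \1_(X j @^-1` `]-oo, r]) w.
have mS : measurable_fun setT S.
  apply: measurable_sum => j; apply: measurable_indic.
  by rewrite -[X in measurable X]setTI; apply: mX.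
have -> : (fun w => order_statistic (X ^~ w) i.+1) @^-1` `]r, +oo[ =
          S @^-1` `]-oo, i%:R].
  apply/seteqP; split=> w; rewrite /= !in_itv/= andbT ltNge order_statistic_le//.
    rewrite -leqNgt -(ler_nat R) natr_sum /S => /(le_trans _); apply.
    by apply: ler_sum => j _; rewrite indic_preimage_ray.
  rewrite -leqNgt -(ler_nat R) natr_sum /S; apply: le_trans.
  by apply: ler_sum => j _; rewrite indic_preimage_ray.
by rewrite -[X in measurable X]setTI; apply: mS.
Qed.

Lemma measurable_spacing_path d (T : measurableType d) (R : realType) n
    (X : 'I_n.-1 -> T -> R) t : (forall j, measurable_fun setT (X j)) ->
  measurable_fun setT (fun w => spacing_path (X ^~ w) t).
Proof.
move=> mX; under eq_fun do rewrite spacing_pathE.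
have mO i := measurable_order_statistic i mX.
by apply: measurable_funD => //; apply: measurable_funM => //; apply: measurable_funB.
Qed.

Section supnorm01.
Context (R : realType).
Implicit Types (h : R -> R) (r t : R).

Lemma supnorm01_le h r : (forall t, 0 <= t <= 1 -> `|h t| <= r) ->
  supnorm01 h <= r.
Proof.
move=> hr; apply: sup_le_ub => [|_ [t /= + <-]].
  by exists `|h 0|, 0 => //=; rewrite in_itv/= lexx ler01.
by rewrite in_itv/=; exact: hr.
Qed.

(** A real [sup] is an upper bound only for a set that is bounded above, which the extreme value
    theorem provides. *)
Lemma le_supnorm01 h t : C01 h -> 0 <= t <= 1 -> `|h t| <= supnorm01 h.
Proof.
move=> ch t01; apply: ub_le_sup; last by exists t.
have ch' : {within `[0, 1], continuous (fun x => `|h x|)}.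
  by move=> x; apply: cvg_norm; exact: ch.
have [c _ hc] := EVT_max ler01 ch'.
by exists `|h c| => _ [s s01 <-]; exact: hc.
Qed.

Lemma comp_clip01_continuous h : C01 h -> continuous (h \o @clip01 R).
Proof.
move=> /subspace_continuousP ch x.
have /ch : `[0%R : R, 1%R]%classic (clip01 x) by rewrite /= in_itv/= clip01_in01.
move=> hx A /hx hA.
have : nbhs x (@clip01 R @^-1` [set y | `[0%R : R, 1%R]%classic y -> A (h y)]).
  exact: (@clip01_continuous R x).
by apply: filterS => y /=; apply; rewrite in_itv/= clip01_in01.
Qed.

(** A countable criterion, made for measurability. The slack [k.+1%:R^-1] keeps the inequality
    strict after passing from the rationals to the supremum, and clipping sends every rational into
    [[0, 1]]. *)
Lemma supnorm01_ltP h r : C01 h -> (supnorm01 h < r) <->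
  exists k : nat, forall q : rat, `|h (clip01 (ratr q))| <= r - k.+1%:R^-1.
Proof.
move=> ch; split=> [/ltr_add_invr[k hk]|[k hk]].
  exists k => q; rewrite lerBrDr (le_trans _ (ltW hk))// lerD2r.
  by rewrite le_supnorm01// clip01_in01.
apply: (@le_lt_trans _ _ (r - k.+1%:R^-1)); last by rewrite ltrBlDr ltrDl invr_gt0.
apply: supnorm01_le => t t01; rewrite leNgt; apply/negP => rt.
(* By continuity of the clipped function, the violations form an open set; it contains [t], hence
   some rational. *)
have [||x [/= hx [q _ qx]]] := @dense_rat R
    [set x | r - k.+1%:R^-1 < `|h (clip01 x)|].
- by exists t; rewrite /= clip01_id.
- rewrite (_ : mkset _ = (fun x => `|(h \o @clip01 R) x|) @^-1` [set x | r - k.+1%:R^-1 < x])//.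
  apply: open_comp; last exact: open_gt.
  by move=> x _; apply: cvg_norm; exact: comp_clip01_continuous.
by move: hx; rewrite -qx ltNge hk.
Qed.

End supnorm01.

(** By the rational criterion, the event is a countable union of countable intersections of events
    about a single time. *)
Lemma measurable_supnorm01_lt d (T : measurableType d) (R : realType)
    (h : T -> R -> R) r :
  (forall w, C01 (h w)) -> (forall t, measurable_fun setT (h ^~ t)) ->
  measurable [set w | supnorm01 (h w) < r].
Proof.
move=> ch mh.
rewrite (_ : mkset _ = \bigcup_(k : nat) \bigcap_(q : rat)
    [set w | `|h w (clip01 (ratr q))| <= r - k.+1%:R^-1]); last first.
  apply/seteqP; split=> w /=; first by move/supnorm01_ltP => -[//|k hk]; exists k => // q _ /=.
  by move=> [k _ hk]; apply/supnorm01_ltP => //; exists k => q; exact: hk.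
apply: bigcupT_measurable => k; rewrite -[X in measurable X]setCK setC_bigcap.
apply: measurableC; apply: bigcupT_measurable_rat => q; apply: measurableC.
rewrite (_ : mkset _ = (fun w => `|h w (clip01 (ratr q))|) @^-1` `]-oo, r - k.+1%:R^-1]); last first.
  by apply/seteqP; split=> w; rewrite /= in_itv.
rewrite -[X in measurable X]setTI.
by apply: (measurableT_comp (@normr_measurable _ setT) (mh _)).
Qed.

(** * Chebyshev's inequality for counts of independent events *)

(** Induction on the list: the cross term is twice the covariance of the head with the sum of the
    tail, which vanishes by additivity since a duplicate-free list never pairs an index with
    itself. *)
Lemma variance_sum_uncorrelated d (T : measurableType d) (R : realType)
    (P : probability T R) (I : eqType) (s : seq I) (X : I -> T -> R) :
  uniq s -> (forall i, X i \in Lfun P 2%:E) ->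
  (forall i j, i != j -> covariance P (X i) (X j) = 0%E) ->
  'V_P[\sum_(i <- s) X i] = (\sum_(i <- s) 'V_P[X i])%E.
Proof.
move=> + L2 cov0.
have sumL2 (r : seq I) : \sum_(i <- r) X i \in Lfun P 2%:E.
  elim: r => [|i r IH]; first by rewrite big_nil (Lfun_cst P 0).
  by rewrite big_cons rpredD// lee1n.
have cov_sum (r : seq I) i : i \notin r ->
    covariance P (X i) (\sum_(j <- r) X j) = 0%E.
  elim: r => [_|j r IH]; first by rewrite big_nil (covariance_cst_r _ _ 0).
  rewrite inE negb_or => /andP[ij /IH ir].
  by rewrite big_cons covarianceDr// ir cov0// adde0.
elim: s => [_|i s IH /= /andP[si us]].
  by rewrite !big_nil (variance_cst _ 0).
rewrite !big_cons -IH// varianceD//.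
by rewrite cov_sum// mule0 adde0.
Qed.

(** An indicator is its own square, so its second moment is the probability of the event. *)
Lemma Lfun2_indic d (T : measurableType d) (R : realType)
    (P : probability T R) (A : set T) :
  measurable A -> (\1_A : T -> R) \in Lfun P 2%:E.
Proof.
move=> mA; rewrite inE/=; apply/andP; split; rewrite inE//=.
rewrite /finite_norm unlock poweR_lty//.
under eq_integral => x _/=.
  rewrite (_ : `|\1_A x| `^ 2 = \1_A x)//; last first.
    by rewrite indicE; case: (_ \in _); rewrite ?normr1 ?normr0 ?powR1// powR0.
  over.
by rewrite integral_indic// setIT (le_lt_trans (probability_le1 _ _))// ltry.
Qed.

Lemma covariance_indic d (T : measurableType d) (R : realType)
    (P : probability T R) (A B : set T) :
  measurable A -> measurable B ->
  covariance P (\1_A) (\1_B) = (P (A `&` B) - P A * P B)%E.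
Proof.
move=> mA mB; have mAB := measurableI _ _ mA mB.
have L1 C : measurable C -> (\1_C : T -> R) \in Lfun P 1.
  by move=> mC; rewrite Lfun_subset12 ?fin_num_measure ?Lfun2_indic.
by rewrite covarianceE; [|exact: L1|exact: L1|]; rewrite -[\1_A * \1_B]indicI ?L1// !expectation_indic.
Qed.

(** Pairwise independence cancels all covariances, so the variance of the count is a sum of [m]
    indicator variances, each at most 1. *)
Lemma chebyshev_count d (T : measurableType d) (R : realType)
    (P : probability T R) m (A : 'I_m -> set T) (p e : R) :
  0 < e -> (forall i, measurable (A i)) -> (forall i, P (A i) = p%:E) ->
  (forall i j, i != j -> P (A i `&` A j) = (P (A i) * P (A j))%E) ->
  (P [set w | (e <= `|\sum_(i < m) \1_(A i) w - m%:R * p|)%R] <=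
   (m%:R / e ^+ 2)%:E)%E.
Proof.
move=> e0 mA PA PAA.
pose S : T -> R := \sum_(i < m) \1_(A i).
have SE w : S w = \sum_(i < m) \1_(A i) w by rewrite /S fct_sumE.
have mS : measurable_fun setT S.
  rewrite (_ : S = fun w => \sum_(i < m) \1_(A i) w); last exact/funext.
  by apply: measurable_sum => i; exact: measurable_indic.
pose SX : {RV P >-> R} := HB.pack S (isMeasurableFun.Build _ _ _ _ _ mS).
have ES : ('E_P[S])%E = (m%:R * p)%:E.
  rewrite /S -(big_map (fun i => \1_(A i)) xpredT id).
  rewrite expectation_sum; last first.
    move=> _ /mapP[i _ ->]; rewrite Lfun_subset12 ?fin_num_measure//.
    exact: Lfun2_indic.
  rewrite big_map; under eq_bigr do rewrite expectation_indic// PA.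
  by rewrite sumEFin big_const_ord iter_addr_0 mulr_natl.
have VS : ('V_P[S] <= m%:R%:E)%E.
  rewrite /S variance_sum_uncorrelated ?index_enum_uniq//; first last.
  - move=> i j ij; rewrite covariance_indic// PAA// subee//.
    by rewrite fin_numM// fin_num_measure.
  - by move=> i; exact: Lfun2_indic.
  apply: (@le_trans _ _ (\sum_(i < m) 1%:E)%E); last first.
    by rewrite sumEFin big_const_ord iter_addr_0.
  apply: lee_sum => i _; rewrite /variance covariance_indic// setIid.
  apply: (@le_trans _ _ (P (A i))); last exact: probability_le1.
  by rewrite leeBlDr ?fin_numM ?fin_num_measure// leeDl// mule_ge0.
have := @chebyshev _ _ _ P SX e e0.
rewrite [('E_P[SX])%E]ES /=.
under eq_set do rewrite SE.
move=> /le_trans; apply.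
by rewrite mulrC EFinM lee_pmul2l// lte_fin invr_gt0 exprn_gt0.
Qed.

(** * Convergence *)

(* F increases by at least c / m over a cell of the grid {j / m}, that is by
   2 a / (n - 1); a deviation smaller than a at the grid points therefore moves
   an order statistic by at most one cell. *)
Lemma spacing_path_near (R : realType) (F Q : R -> R) (a c : R) n (x : 'I_n.-1 -> R) m :
  0 < c -> (0 < m)%N -> (0 < n)%N ->
  (forall u v, 0 <= u -> u <= v -> v <= 1 -> c * (v - u) <= F v - F u) ->
  (forall t, 0 <= t <= 1 -> 0 <= Q t <= 1) ->
  (forall t, 0 <= t <= 1 -> F (Q t) = t) ->
  (forall i, 0 <= x i <= 1) ->
  a = n.-1%:R * (c / (2 * m%:R)) -> 2 <= a ->
  (forall j, (j <= m)%N ->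
    `|\sum_(i < n.-1) (x i <= j%:R / m%:R)%R%:R - n.-1%:R * F (j%:R / m%:R)| < a) ->
  forall t, 0 <= t <= 1 -> `|spacing_path x t - Q t| <= 2 / m%:R.
Proof.
move=> c0 m0 n0 Fc Q01 QK x01 aE a2 xF t t01.
have /andP[t0 t1] := t01; have /andP[Q0 Q1] := Q01 _ t01.
set q := Q t in Q0 Q1 *; have Fq : F q = t by exact: QK.
have nE : n%:R = n.-1%:R + 1 :> R by rewrite natr1 prednK.
have mR0 : 0 < m%:R :> R by rewrite ltr0n.
set N : R := n.-1%:R in nE aE xF *; have N0 : 0 <= N by rewrite ler0n.
pose u : R := m%:R^-1; have u0 : 0 < u by rewrite invr_gt0.
have Nu : N * (c * u) = 2 * a.
  by rewrite aE /u; field; rewrite gt_eqF.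
(* The index of the grid cell containing [q]: [j / m <= q < j.+1 / m]. *)
pose j := Num.truncn (m%:R * q).
have /andP[jq qj] : j%:R <= m%:R * q < j.+1%:R by rewrite truncn_itv// mulr_ge0// ltW.
have {}jq : j%:R * u <= q by rewrite ler_pdivrMr// mulrC.
have {}qj : q < j%:R * u + u.
  by rewrite -[X in _ + X]mul1r -mulrDl natr1 ltr_pdivlMr// mulrC.
(* Ranks within 1 of [n t] cover the two order statistics between which the path interpolates. *)
have near_q i : (i <= n)%N -> i%:R <= n%:R * t + 1 -> n%:R * t - 1 <= i%:R ->
    q - 2 * u <= order_statistic x i <= q + 2 * u.
  move=> ni int nti; have /andP[s0 s1] := order_statistic_in01 x01 ni.
  apply/andP; split.
    (* Going back to [j.-1 / m] leaves at least a full cell before [q]: the count there is below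
       [N t - a], hence below [i] as [2 <= a]. If [j = 0], then [q - 2 * u] is negative. *)
    case: j jq qj => [|j'] jq qj; first by lra.
    have j'E : j'.+1%:R * u = j'%:R * u + u by rewrite -natr1 mulrDl mul1r.
    have y0 : 0 <= j'%:R * u by rewrite mulr_ge0// ltW.
    have y1 : j'%:R * u <= 1 by lra.
    have j'm : (j' <= m)%N by rewrite -(ler_nat R) -[leRHS]mul1r -ler_pdivrMr.
    suff : j'%:R * u <= order_statistic x i by lra.
    apply: order_statistic_lb => //; rewrite -(ltr_nat R) natr_sum.
    have := xF _ j'm; rewrite -/u ltr_norml => /andP[_ hx].
    have : c * (q - j'%:R * u) <= F q - F (j'%:R * u) by apply: Fc => //; lra.
    have : c * u <= c * (q - j'%:R * u) by rewrite ler_pM2l//; lra.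
    rewrite Fq => h1 h2.
    have : N * F (j'%:R * u) <= N * (t - c * u) by rewrite ler_wpM2l//; lra.
    rewrite mulrBr Nu => h3.
    rewrite nE in nti.
    rewrite (lt_le_trans _ nti)//; lra.
  (* Symmetrically, the count at [j.+2 / m] exceeds [N t + a], hence [n t + 1] as [2 <= a]. If that
     grid point lies beyond 1, so does [q + 2 * u]. *)
  have [jm|mj] := leqP j.+2 m; last first.
    rewrite (le_trans s1)//.
    have : m%:R * u <= j.+2%:R * u by apply: ler_wpM2r; [exact: ltW | rewrite ler_nat ltnW].
    by rewrite divff ?gt_eqF// -natr1 -natr1 !mulrDl mul1r; lra.
  have jE : j.+2%:R * u = j%:R * u + 2 * u by rewrite -natr1 -natr1 !mulrDl; lra.
  have j0 : 0 <= j%:R * u by rewrite mulr_ge0// ltW.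
  have y1 : j.+2%:R * u <= 1 by rewrite ler_pdivrMr// mul1r ler_nat.
  suff : order_statistic x i <= j.+2%:R * u by lra.
  apply: order_statistic_ub => //; first by lra.
  rewrite -(ler_nat R) natr_sum.
  have := xF _ jm; rewrite -/u ltr_norml => /andP[hx _].
  have : c * (j.+2%:R * u - q) <= F (j.+2%:R * u) - F q by apply: Fc => //; lra.
  have : c * u <= c * (j.+2%:R * u - q) by rewrite ler_pM2l//; lra.
  rewrite Fq => h1 h2.
  have : N * (t + c * u) <= N * F (j.+2%:R * u) by rewrite ler_wpM2l//; lra.
  rewrite mulrDr Nu => h3.
  rewrite nE in int.
  rewrite (le_trans int)//; lra.
rewrite spacing_pathE -/u.
set k := Num.truncn (n%:R * t).
have /andP[kt tk] : k%:R <= n%:R * t < k.+1%:R by rewrite truncn_itv// mulr_ge0.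
have kn : (k <= n)%N by rewrite -(ler_nat R) (le_trans kt)// ler_piMr.
rewrite -natr1 in tk.
have /andP[sk1 sk2] : q - 2 * u <= order_statistic x k <= q + 2 * u.
  by apply: near_q => //; lra.
move: kn; rewrite leq_eqVlt => /predU1P[kn|kn].
  have -> : n%:R * t - k%:R = 0.
    by apply/eqP; rewrite subr_eq0 eq_le kt andbT kn ler_piMr.
  by rewrite mul0r addr0 ler_norml; lra.
have /andP[sl1 sl2] : q - 2 * u <= order_statistic x k.+1 <= q + 2 * u.
  by apply: near_q => //; rewrite -natr1; lra.
have : 0 <= n%:R * t - k%:R by lra.
have : n%:R * t - k%:R <= 1 by lra.
move: (n%:R * t - k%:R) => th th1 th0.
have th1' : 0 <= 1 - th by lra.
(* [th] and [1 - th] are the weights of the convex combination; the products with the bounds are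
   supplied because [lra] is linear. *)
have := ler_wpM2l th0 sl1; have := ler_wpM2l th0 sl2.
have := ler_wpM2l th1' sk1; have := ler_wpM2l th1' sk2.
by move=> *; rewrite ler_norml; lra.
Qed.

(** A union bound over a [finType], so that the bad events can be indexed by a sum type;
    subadditivity is iterated along the enumeration. *)
Lemma le_measure_finite_cover d (T : measurableType d) (R : realType)
    (mu : {measure set T -> \bar R}) (I : finType) (A : I -> set T) (B : set T) :
  measurable B -> (forall i, measurable (A i)) -> B `<=` \bigcup_i A i ->
  (mu B <= \sum_i mu (A i))%E.
Proof.
move=> mB mA BA.
have H (s : seq I) : (mu (\big[setU/set0]_(i <- s) A i) <= \sum_(i <- s) mu (A i))%E.
  elim: s => [|i s IH]; first by rewrite !big_nil measure0.
  rewrite !big_cons (le_trans (measureU2 _ _ _))//; first exact: bigsetU_measurable.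
  exact: leeD2l.
apply: le_trans (H (index_enum I)); apply: le_measure; rewrite ?inE//.
  exact: bigsetU_measurable.
move=> w /BA [i _ Aw]; rewrite -bigcup_seq; exists i => //=.
exact: mem_index_enum.
Qed.

Lemma mutually_independent_pair d (T : measurableType d) (R : realType)
    (P : probability T R) m (X : 'I_m -> {RV P >-> R}) (B : set R) i j :
  mutually_independent P X -> measurable B -> i != j ->
  P (X i @^-1` B `&` X j @^-1` B) = (P (X i @^-1` B) * P (X j @^-1` B))%E.
Proof.
move=> indX mB ij; have := indX [set i; j]%SET (fun=> B) (fun=> mB).
rewrite big_setU1 ?inE//= big_set1 => <-; congr (P _).
apply/seteqP; split=> w /=; first by move=> [wi wj] k /=; rewrite !inE => /orP[] /eqP ->.
by move=> h; split; apply: h; rewrite /= !inE eqxx ?orbT.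
Qed.

(** The distribution function only measures rays, so the event is covered by [X <= 0] and [X > 1],
    of probabilities [F 0] and [1 - F 1]. *)
Lemma outside01_null d (T : measurableType d) (R : realType)
    (P : probability T R) (F : R -> R) (X : {RV P >-> R}) :
  F 0 = 0 -> F 1 = 1 -> (forall r, cdf X r = (F r)%:E) ->
  P (X @^-1` (~` `[0, 1])) = 0%E.
Proof.
move=> F0 F1 XF; apply/eqP; rewrite eq_le measure_ge0 andbT.
have mX (A : set R) : measurable A -> measurable (X @^-1` A).
  by move=> mA; rewrite -[X in measurable X]setTI; exact: measurable_funPT.
have m0 : measurable (X @^-1` `]-oo, 0]) by exact: mX.
have m1 : measurable (X @^-1` `]-oo, 1]) by exact: mX.
have P0 : P (X @^-1` `]-oo, 0]) = 0%E by rewrite -[LHS]/(cdf X 0) XF F0.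
have P1 : P (~` (X @^-1` `]-oo, 1])) = 0%E.
  by rewrite probability_setC// -[P _]/(cdf X 1) XF F1 subee.
apply: (@le_trans _ _ (P (X @^-1` `]-oo, 0] `|` ~` (X @^-1` `]-oo, 1])))).
  apply: le_measure; rewrite ?inE; [|by apply: measurableU => //; exact: measurableC|].
    by apply: mX; exact: measurableC.
  move=> w /=; rewrite !in_itv/= => /negP; rewrite negb_and -!ltNge => /orP[/ltW|X1].
    by left.
  by right; apply/negP; rewrite -ltNge.
rewrite (le_trans (measureU2 _ _ _))//; first exact: measurableC.
by rewrite [X in (X <= _)%E](_ : _ = 0%E) //= P0 P1 adde0.
Qed.

Theorem corollary1 (R : realType) (F f f' : R -> R)
  (F_df : distribution_function01 F)
  (F_ac : absolutely_continuous F)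
  (F_f : is_derivative01 F f)
  (f_f' : is_derivative01 f f')
  (f_inf : (0 < ereal_inf [set (f (quantile01 F x))%:E | x in `[0%R : R, 1%R]])%E)
  (f'_sup :
    (ereal_sup [set `|f' (quantile01 F x)|%:E | x in `[0%R : R, 1%R]] < +oo)%E)
  (d : measure_display) (T : measurableType d) (P : probability T R)
  (X : forall n : nat, 'I_n.-1 -> {RV P >-> R})
  (X_iid : forall n : nat, (2 <= n)%N -> iid_with_cdf P (X n) F) :
  cvg_in_probability_C01 P
    (fun n w => spacing_path (fun i => X n i w)) (quantile01 F).
Proof.
have F0 := df0 F_df F_ac; have F1 := df1 F_df.
have [c c0 Fc] := df_expanding F_df F_ac F_f f_inf.
have CQ : C01 (quantile01 F) := quantile01_continuous F_df F_ac F_f f_inf.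
set Q := quantile01 F in CQ *.
pose Y n w := spacing_path (fun i => X n i w).
have mX n i (A : set R) : measurable A -> measurable (X n i @^-1` A).
  by move=> mA; rewrite -[X in measurable X]setTI; exact: measurable_funPT.
have CYB n w g : C01 g -> C01 (Y n w \- g).
  by move=> Cg t; apply: continuousB; [exact: spacing_path_continuous | exact: Cg].
(* A general [g] serves the Borel property; [g = Q] makes the deviation event measurable, as a
   complement. *)
have mY n g r : C01 g -> measurable [set w | supnorm01 (Y n w \- g) < r].
  move=> Cg; apply: measurable_supnorm01_lt => [w|t]; first exact: CYB.
  apply: measurable_funB; last exact: measurable_cst.
  by apply: measurable_spacing_path => j; exact: measurable_funPT.
split => //.
  by apply: nearW => n; split=> [w|g r Cg]; [exact: spacing_path_continuous | exact: mY].
(* This [m] makes the error [2 / m] of the deterministic estimate smaller than [e]. *)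
move=> e e0; pose m := (Num.truncn (2 / e)).+1.
have m0 : 0 < m%:R :> R by rewrite ltr0n.
have me : 2 / m%:R < e by rewrite ltr_pdivrMr// mulrC -ltr_pdivrMr// truncnS_gt.
(* [a n] is half the increase of [n.-1%:R * F] guaranteed over one grid cell; [K / n.-1%:R] is the
   sum of the Chebyshev bounds [n.-1%:R / a n ^+ 2] over the [m.+1] grid points. *)
pose a n : R := n.-1%:R * (c / (2 * m%:R)).
pose K : R := m.+1%:R * (2 * m%:R / c) ^+ 2.
have PY n : (2 <= n)%N -> 2 <= a n ->
    (P [set w | (e <= supnorm01 (Y n w \- Q))%R] <= (K / n.-1%:R)%:E)%E.
  move=> n2 an; have [indX XF] := X_iid n n2.
  have a0 : 0 < a n by rewrite (lt_le_trans _ an).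
  pose A (j : nat) i := X n i @^-1` `]-oo, j%:R / m%:R].
  pose dev (j : nat) w : R :=
    \sum_(i < n.-1) \1_(A j i) w - n.-1%:R * F (j%:R / m%:R).
  have mA j i : measurable (A j i) by exact: mX.
  (* The bad events: a sample point outside [[0, 1]], or a large deviation of the count at a grid
     point. *)
  pose E (k : 'I_n.-1 + 'I_m.+1) : set T := match k with
    | inl i => X n i @^-1` (~` `[0, 1])
    | inr j => [set w | a n <= `|dev j w|] end.
  have mE k : measurable (E k).
    case: k => [i|j] /=; first by apply: mX; exact: measurableC.
    rewrite (_ : mkset _ = (fun w => `|dev j w|) @^-1` `[a n, +oo[); last first.
      by apply/seteqP; split=> w; rewrite /= in_itv/= andbT.
    rewrite -[X in measurable X]setTI.
    apply: (measurableT_comp (@normr_measurable _ setT)) => //.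
    apply: measurable_funB; last exact: measurable_cst.
    by apply: measurable_sum => i; exact: measurable_indic.
  have YE : [set w | (e <= supnorm01 (Y n w \- Q))%R] `<=` \bigcup_k E k.
    move=> w /= ew; apply: contrapT => nE.
    have nEk k : ~ E k w by move=> Ek; apply: nE; exists k.
    suff : supnorm01 (Y n w \- Q) <= 2 / m%:R.
      by move/(le_lt_trans)/(_ me); rewrite ltNge ew.
    apply: supnorm01_le => t t01 /=.
    apply: (spacing_path_near (F := F) (c := c) (a := a n)) => //.
    - exact: ltnW.
    - exact: quantile01_in01.
    - exact: quantile01K.
    - by move=> i; have := nEk (inl i) => /= /contrapT; rewrite /= in_itv.
    - move=> j jm; rewrite ltNge; apply/negP => aj.
      apply: (nEk (inr (inord j))) => /=; rewrite inordK ?ltnS// /dev.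
      by under eq_bigr do rewrite indic_preimage_ray.
  apply: (le_trans (le_measure_finite_cover P _ mE YE)).
    rewrite (_ : mkset _ = ~` [set w | supnorm01 (Y n w \- Q) < e]).
      by apply: measurableC; exact: mY.
    by apply/seteqP; split=> w /= ew; [apply/negP; rewrite -leNgt | rewrite leNgt; apply/negP].
  (* The bad events of the first kind are null, so only the Chebyshev terms remain. *)
  rewrite big_sumType/= big1 ?add0e => [|i _]; last exact: outside01_null (XF i).
  have Ej (j : 'I_m.+1) : true -> (P (E (inr j)) <= (n.-1%:R / a n ^+ 2)%:E)%E.
    move=> _; apply: chebyshev_count => //.
    - by move=> i; rewrite -[LHS]/(cdf (X n i) _) XF.
    - by move=> i k ik; exact: mutually_independent_pair.
  rewrite (le_trans (lee_sum _ Ej))//.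
  rewrite sumEFin big_const_ord iter_addr_0 -[in leLHS]mulr_natl lee_fin.
  rewrite le_eqVlt; apply/orP; left; apply/eqP; rewrite /K /a; field.
  by rewrite !gt_eqF// ltr0n -ltnS prednK// ltnW.
(* [harmonic n] is [n.+1%:R^-1]; the factor 2 comes from [1 / (n - 1) <= 2 / (n + 1)], valid for
   [3 <= n]. *)
apply: (@squeeze_cvge _ _ _ _ (cst 0%E) _ (fun n => (2 * K * harmonic n)%:E)).
- near=> n; rewrite measure_ge0/=; apply: (le_trans (PY n _ _)).
  + by near: n; exists 2%N.
  (* This threshold is [2 <= a n] solved for [n]. *)
  + have : 4 * m%:R / c + 1 <= n%:R by near: n; exact: nbhs_infty_ger.
    have -> : n%:R = n.-1%:R + 1 :> R by rewrite natr1 prednK//; near: n; exists 1%N.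
    rewrite lerD2r ler_pdivrMr// => hn.
    by rewrite /a mulrA ler_pdivlMr ?mulr_gt0//; lra.
  + have n3 : (3 <= n)%N by near: n; exists 3%N.
    have n1 : 0 < n.-1%:R :> R by rewrite ltr0n -ltnS prednK ltnW// ltnW.
    rewrite lee_fin /harmonic/= [2 * K]mulrC -[leRHS]mulrA ler_wpM2l//.
      by rewrite mulr_ge0// sqr_ge0.
    rewrite ler_pdivlMr// mulrC ler_pdivrMr//.
    rewrite -natrM ler_nat.
    by case: (n) n3 => [|[|[|k]]]//= _; rewrite ?muln2 ?mul2n -addnn !addSn !ltnS leq_addl.
- exact: cvg_cst.
- rewrite -[X in _ --> X%:E](mulr0 (2 * K)).
  by apply: cvg_EFin; [exact: nearW | apply: cvgM; [exact: cvg_cst | exact: cvg_harmonic]].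
Unshelve. all: by end_near. Qed.
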